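(* Let $p$ be a prime, $d\ge1$ an integer, and let $(X_n)_{n\ge0}$ be a $\mathbb{Z}_p^d$-tower of strongly connected digraphs. For all $n\ge1$, $$\delta(X_n)\ge\delta(X_{n-1}).$$
   Context: **Digraphs and towers.** A digraph $X$ consists of finite sets $V(X)$ (vertices) and $\mathbb{E}(X)$ (directed edges) with an incidence map $e\mapsto(o(e),t(e))\in V(X)\times V(X)$. It is strongly connected if for all $(v,v')$ there is a directed path from $v$ to $v'$. A morphism of digraphs is a pair of maps on vertices and edges commuting with incidence. A covering $Y\to X$ is a surjective morphism $f$ which for each $v\in V(Y)$ induces bijections from the incoming (resp. outgoing) edges at $v$ to those at $f(v)$. It is $m$-sheeted if each vertex of $X$ has $m$ preimages, and Galois if it is $m$-sheeted with $|\mathrm{Deck}(Y/X)|=m$ for some $m$, where $\mathrm{Deck}(Y/X)$ (the Galois group) is the group of automorphisms of $Y$ over $X$. A $\mathbb{Z}_p^d$-tower over $X$ is a sequence of coverings $X=X_0\leftarrow X_1\leftarrow X_2\leftarrow\cdots$ such that each $X_n/X$ is Galois with group isomorphic to $(\mathbb{Z}/p^n\mathbb{Z})^d$; it is a tower of strongly connected digraphs if all $X_n$ are strongly connected. **Defect.** For a digraph $X$ with vertices $v_1,\dots,v_r$, let $A_X$ be the matrix whose $(i,j)$-entry is the number of edges from $v_j$ to $v_i$. The zeta function is $Z_X(u)=\prod_{[C]}(1-u^{|[C]|})^{-1}$, where $[C]$ runs over primes of $X$, i.e. equivalence classes (under cyclic permutation) of directed cycles (closed directed paths) that are not an $m$-fold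 multiple of another cycle for any $m\ge2$, and $|[C]|$ is the number of edges; it equals the rational function $\det(\mathrm{Id}-uA_X)^{-1}$. The Bowen–Franks group is $\mathcal{BF}(X)=\mathbb{Z}^r/(\mathrm{Id}-A_X)\mathbb{Z}^r$. The algebraic Bowen–Franks rank is $b(X)=\mathrm{rank}_{\mathbb{Z}}\mathcal{BF}(X)$; the analytic Bowen–Franks rank is $a(X)=-\mathrm{ord}_{u=1}Z_X(u)$; the defect is $\delta(X)=a(X)-b(X)$. *)

(* Defs.v *)
From HB Require Import structures.
From mathcomp Require Import all_boot all_order all_algebra all_fingroup.
From mathcomp Require Import ring_quotient generic_quotient fraction boolp.
From mathcomp Require classical_sets.

Set Implicit Arguments.
Unset Strict Implicit.
Unset Printing Implicit Defensive.

Import Order.TTheory GRing.Theory Num.Theory.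
Local Open Scope ring_scope.

Record digraph := Digraph {
  vertex : finType;
  edge : finType;
  org : edge -> vertex;
  tgt : edge -> vertex
}.
Arguments org {d}.
Arguments tgt {d}.

Definition out_edges (X : digraph) (v : vertex X) : {set edge X} :=
  [set e | org e == v].

Definition in_edges (X : digraph) (v : vertex X) : {set edge X} :=
  [set e | tgt e == v].

Definition strongly_connected (X : digraph) : Prop :=
  forall v w : vertex X,
    connect [rel x y | [exists e : edge X, (org e == x) && (tgt e == y)]] v w.

Record dihom (Y X : digraph) := DiHom {
  vmap : vertex Y -> vertex X;
  emap : edge Y -> edge X;
  vmap_org : forall e, vmap (org e) = org (emap e);
  vmap_tgt : forall e, vmap (tgt e) = tgt (emap e)
}.

Definition dihom_id (X : digraph) : dihom X X :=
  @DiHom X X id id (fun=> erefl) (fun=> erefl).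

Lemma dihom_comp_org (Z Y X : digraph) (f : dihom Y X) (g : dihom Z Y) e :
  vmap f (vmap g (org e)) = org (emap f (emap g e)).
Proof. by rewrite !vmap_org. Qed.

Lemma dihom_comp_tgt (Z Y X : digraph) (f : dihom Y X) (g : dihom Z Y) e :
  vmap f (vmap g (tgt e)) = tgt (emap f (emap g e)).
Proof. by rewrite !vmap_tgt. Qed.

Definition dihom_comp (Z Y X : digraph) (f : dihom Y X) (g : dihom Z Y) :
    dihom Z X :=
  @DiHom Z X (vmap f \o vmap g) (emap f \o emap g)
    (dihom_comp_org f g) (dihom_comp_tgt f g).

Definition covering (Y X : digraph) (f : dihom Y X) : Prop :=
  [/\ forall v, exists w, vmap f w = v,
      forall e, exists e', emap f e' = e
    & forall w : vertex Y,
        [/\ {in in_edges w &, injective (emap f)},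
            emap f @: in_edges w = in_edges (vmap f w),
            {in out_edges w &, injective (emap f)}
          & emap f @: out_edges w = out_edges (vmap f w)]].

Definition sheeted (m : nat) (Y X : digraph) (f : dihom Y X) : Prop :=
  forall v : vertex X, #|[set w | vmap f w == v]| = m.

(* A morphism with both components bijective has an inverse morphism, so the
   automorphisms of Y are the pairs of permutations commuting with incidence.
   The product of such pairs is composition in diagrammatic order. *)
Definition deck (Y X : digraph) (f : dihom Y X) :
    {set {perm vertex Y} * {perm edge Y}} :=
  [set g : {perm vertex Y} * {perm edge Y} |
    [&& [forall e, g.1 (org e) == org (g.2 e)],
        [forall e, g.1 (tgt e) == tgt (g.2 e)],
        [forall v, vmap f (g.1 v) == vmap f v]
      & [forall e, emap f (g.2 e) == emap f e]]].

Lemma deck_group_set (Y X : digraph) (f : dihom Y X) : group_set (deck f).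
Proof.
apply/group_setP; split=> [|g h].
  by rewrite inE; apply/and4P; split; apply/forallP => x; rewrite /= !perm1.
rewrite !inE => /and4P[/forallP g1 /forallP g2 /forallP g3 /forallP g4].
move=> /and4P[/forallP h1 /forallP h2 /forallP h3 /forallP h4].
apply/and4P; split; apply/forallP => x; rewrite /= !permM.
- by rewrite (eqP (g1 x)) (eqP (h1 _)).
- by rewrite (eqP (g2 x)) (eqP (h2 _)).
- by rewrite (eqP (h3 _)) (eqP (g3 x)).
- by rewrite (eqP (h4 _)) (eqP (g4 x)).
Qed.

Canonical deck_group (Y X : digraph) (f : dihom Y X) :=
  Group (deck_group_set f).

Definition galois_covering (Y X : digraph) (f : dihom Y X) : Prop :=
  covering f /\ exists m : nat, sheeted m f /\ #|deck f| = m.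

Record tower := Tower {
  level :> nat -> digraph;
  step : forall n, dihom (level n.+1) (level n)
}.

Fixpoint tower_proj (T : tower) (n : nat) : dihom (T n) (T 0%N) :=
  match n with
  | 0 => dihom_id (T 0%N)
  | k.+1 => dihom_comp (tower_proj T k) (step T k)
  end.

(* The group condition is only imposed for 0 < n: there is nothing to require
   of the identity covering of T 0, and 'Z_(p ^ 0) is not the trivial ring. *)
Definition Zpd_tower (p d : nat) (T : tower) : Prop :=
  (forall n, covering (step T n)) /\
  (forall n, (0 < n)%N ->
     galois_covering (tower_proj T n) /\
     deck (tower_proj T n) \isog [set: 'rV['Z_(p ^ n)]_d]).

Definition adjacency (X : digraph) : 'M[int]_#|vertex X| :=
  \matrix_(i, j)
    #|[set e : edge X | (org e == enum_val j) && (tgt e == enum_val i)]|%:Z.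

(* The nonempty closed directed paths, as sequences of edges. *)
Definition closed_path (X : digraph) (s : seq (edge X)) : bool :=
  (0 < size s)%N && path.cycle [rel e e' : edge X | tgt e == org e'] s.

Definition prime_cycle (X : digraph) (s : seq (edge X)) : Prop :=
  closed_path s /\
  forall (m : nat) (c : seq (edge X)),
    (1 < m)%N -> closed_path c -> s <> flatten (nseq m c).

Definition rot_class (X : digraph) (l : nat) (c : l.-tuple (edge X)) :
    {set l.-tuple (edge X)} :=
  [set [tuple of rot k c] | k : 'I_l].

(* The primes [C] with |[C]| = l. *)
Definition primes_of_length (X : digraph) (l : nat) :
    {set {set l.-tuple (edge X)}} :=
  [set rot_class c | c : l.-tuple (edge X) & `[< prime_cycle c >]].

Notation ratfun := {fraction {poly rat}}.

(* Order of vanishing at u = a of a nonzero rational function; independent of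
   the chosen representative, and meaningless for F = 0. *)
Definition ord_at (a : rat) (F : ratfun) : int :=
  (mup a \n_(repr F))%:Z - (mup a \d_(repr F))%:Z.

Definition partial_zeta (X : digraph) (N : nat) : ratfun :=
  \prod_(1 <= l < N.+1) \prod_(C in primes_of_length X l)
    (FracField.tofrac (1 - 'X^l))^-1.

(* u-adic convergence, that is, coefficientwise stabilisation of the power
   series expansions at u = 0. *)
Definition uadic_limit (F : nat -> ratfun) (L : ratfun) : Prop :=
  forall n : nat, exists N0 : nat, forall N : nat, (N0 <= N)%N ->
    L - F N = 0 \/ n%:Z <= ord_at 0 (L - F N).

(* The rational function whose expansion at u = 0 is the Euler product. *)
Definition zeta (X : digraph) : ratfun :=
  classical_sets.xget 0 (uadic_limit (partial_zeta X)).

Definition analytic_rank (X : digraph) : int := - ord_at 1 (zeta X).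

Definition bf_lattice (X : digraph) : {pred 'cV[int]_#|vertex X|} :=
  fun v => `[< exists w, v = (1%:M - adjacency X) *m w >].
Arguments bf_lattice : clear implicits.

Lemma bf_lattice_zmod_closed (X : digraph) : zmod_closed (bf_lattice X).
Proof.
split=> [|_ _ /asboolP[v ->] /asboolP[w ->]]; apply/asboolP.
  by exists 0; rewrite mulmx0.
by exists (v - w); rewrite mulmxBr.
Qed.

HB.instance Definition _ (X : digraph) :=
  GRing.isZmodClosed.Build 'cV[int]_#|vertex X| (bf_lattice X)
    (bf_lattice_zmod_closed X).

Definition bowen_franks (X : digraph) : zmodType := Quotient.quot (bf_lattice X).

Definition zindependent (M : zmodType) (k : nat) (x : 'I_k -> M) : Prop :=
  forall c : 'I_k -> int, \sum_(i < k) x i *~ c i = 0 -> forall i, c i = 0.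

(* The largest size of a Z-linearly independent family; the default value 0
   is never used when M is finitely generated. *)
Definition zrank (M : zmodType) : nat :=
  classical_sets.xget 0%N (fun k : nat =>
    (exists x : 'I_k -> M, zindependent x) /\
    (forall (l : nat) (y : 'I_l -> M), zindependent y -> (l <= k)%N)).

Definition algebraic_rank (X : digraph) : nat := zrank (bowen_franks X).

Definition defect (X : digraph) : int :=
  analytic_rank X - (algebraic_rank X)%:Z.

(* Main.v *)
Require Import Defs.
From mathcomp Require Import all_boot all_order all_algebra.
From mathcomp Require Import all_field.
From mathcomp Require Import ring_quotient generic_quotient fraction boolp.
From mathcomp Require classical_sets.
From mathcomp Require Import zify ring.

(* A covering Y -> X is bijective on outgoing edges, so pulling functions on
   vertices back from X to Y is an injection P with P A_Y = A_X P.  In a basis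
   extending the rows of P the matrix A_Y becomes block triangular with blocks
   A_X and some Q.  The determinant det(1 - u A_Y) is then the product of those
   of the blocks, whereas dim ker(1 - A_Y) is at most the sum of those of the
   blocks; as the geometric multiplicity of the eigenvalue 1 of Q is at most its
   algebraic multiplicity, the defect of Y is at least that of X.

   The zeta function is identified with 1 / det(1 - u A) by comparing power
   sums: -u P'/P = sum_k s_k u^k determines P up to P(0) in characteristic 0.
   For P = det(1 - u A) one has s_k = tr A^k, the number of closed paths of
   length k; for the Euler product s_k is the sum of l pi_l over l | k, with pi_l
   the number of primes of length l.  The two agree because a closed path is
   uniquely a power of a path all of whose rotations are distinct. *)

Set Implicit Arguments.
Unset Strict Implicit.
Unset Printing Implicit Defensive.

Import Order.TTheory GRing.Theory Num.Theory.
Local Open Scope ring_scope.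
Local Open Scope quotient_scope.

(** * Orders of vanishing and u-adic limits *)

Local Notation tofrac := FracField.tofrac.

Lemma frac_numden (R : idomainType) (F : {fraction R}) :
  F = tofrac \n_(repr F) / tofrac \d_(repr F).
Proof.
have d0 : \d_(repr F) != 0 by apply: denom_ratioP.
have n1 := oner_neq0 R.
apply/(canRL (mulfK _)); first by rewrite tofrac_eq0.
rewrite -{1}[F]reprK; unlock FracField.tofrac.
rewrite -[LHS]FracField.pi_mul /FracField.mulf !numden_Ratio //.
apply/eqmodP; rewrite /= FracField.equivfE !numden_Ratio ?mulf_neq0 //.
by rewrite !mulr1 mulrC.
Qed.

(** Cross-multiplying with the chosen representative, additivity of [mup] makes the order
    independent of the representative. *)
Lemma ord_at_frac (a : rat) (p q : {poly rat}) : p != 0 -> q != 0 ->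
  ord_at a (tofrac p / tofrac q) = (mup a p)%:Z - (mup a q)%:Z.
Proof.
move=> p0 q0; rewrite /ord_at; set F := _ / _.
have d0 : \d_(repr F) != 0 by apply: denom_ratioP.
have := frac_numden F; rewrite {1}/F => /eqP.
rewrite eqr_div ?tofrac_eq0 // -!tofracM tofrac_eq => /eqP E.
have n0 : \n_(repr F) != 0.
  by apply: contra_eq_neq E => ->; rewrite mul0r mulf_neq0.
have := congr1 (mup a) E; rewrite !mupM //.
by move: (mup a \n_(repr F)) (mup a \d_(repr F)) => k l; lia.
Qed.

Lemma ord_at_inv (a : rat) (q : {poly rat}) : q != 0 ->
  ord_at a (tofrac q)^-1 = - (mup a q)%:Z.
Proof.
move=> q0; rewrite -[_^-1]mul1r -tofrac1 ord_at_frac ?oner_neq0 //.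
by rewrite mupNroot ?sub0r // root1.
Qed.

(** The ideal generated by [u^n] in the local ring of rational functions regular at 0. In this form
    the case [F = 0] needs no separate treatment and closure under differences is a computation. *)
Definition uadic_small (n : nat) (F : ratfun) : Prop :=
  exists p q : {poly rat}, q.[0] != 0 /\ F = tofrac ('X^n * p) / tofrac q.

Lemma uadic_smallP (n : nat) (F : ratfun) :
  (F = 0 \/ n%:Z <= ord_at 0 F) <-> uadic_small n F.
Proof.
have nz (q : {poly rat}) : q.[0] != 0 -> q != 0.
  by apply: contraNneq => ->; rewrite horner0.
split=> [[->|]|[p [q [q0 ->]]]].
- by exists 0, 1; rewrite hornerC oner_neq0 mulr0 tofrac0 mul0r.
- have [->|F0] := eqVneq F 0.
    by exists 0, 1; rewrite hornerC oner_neq0 mulr0 tofrac0 mul0r.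
  have [p [q [p0 q0 FE]]] :
      exists p q : {poly rat}, [/\ p != 0, q != 0 & F = tofrac p / tofrac q].
    exists \n_(repr F), \d_(repr F); split; [|exact: denom_ratioP|exact: frac_numden].
    by apply: contra_neq F0 => n0; rewrite [F]frac_numden n0 tofrac0 mul0r.
  rewrite FE ord_at_frac //.
  have fac (r : {poly rat}) : r != 0 ->
      exists2 s : {poly rat}, s.[0] != 0 & r = s * 'X^(mup 0 r).
    move=> r0; have [m [s /implyP/(_ r0) s0 rE]] := multiplicity_XsubC r 0.
    exists s => //; by rewrite {2}rE mupMr // mup_XsubCX eqxx {1}rE polyC0 subr0.
  have [s s0 pE] := fac p p0; have [t t0 qE] := fac q q0.
  move=> le; exists ('X^(mup 0 p - mup 0 q - n) * s), t; split=> //.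
  have tn0 := nz t t0; apply/eqP; rewrite eqr_div ?tofrac_eq0 //.
  rewrite -!tofracM tofrac_eq {1}pE {2}qE.
  have -> : mup 0 p = (n + (mup 0 p - mup 0 q - n) + mup 0 q)%N.
    by move: (mup 0 p) (mup 0 q) le => i j; lia.
  rewrite addnK addKn !exprD; apply/eqP.
  by move: 'X^n 'X^(_ - _ - _) 'X^(mup 0 q) => x y z; ring.
- have [->|p0] := eqVneq p 0; first by left; rewrite mulr0 tofrac0 mul0r.
  have qn0 := nz q q0; right; rewrite ord_at_frac ?mulf_neq0 ?expf_neq0 ?polyX_eq0 //.
  rewrite mupM ?expf_neq0 ?polyX_eq0 // (mupNroot (x := 0) (q := q)) //.
  by have := mup_XsubCX n (0 : rat) 0; rewrite polyC0 subr0 eqxx => ->; lia.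
Qed.

Lemma uadic_smallB (n : nat) (F G : ratfun) :
  uadic_small n F -> uadic_small n G -> uadic_small n (F - G).
Proof.
move=> [p [q [q0 ->]]] [r [s [s0 ->]]].
have nz (t : {poly rat}) : t.[0] != 0 -> t != 0.
  by apply: contraNneq => ->; rewrite horner0.
exists (p * s - r * q), (q * s); split; first by rewrite hornerM mulf_neq0.
rewrite -mulNr addf_div ?tofrac_eq0 ?nz // -tofracN -!tofracM -tofracD.
by congr (tofrac _ / _); ring.
Qed.

Lemma uadic_small_all (F : ratfun) : (forall n, uadic_small n F) -> F = 0.
Proof.
move=> small; apply/eqP/negP => /negP F0.
have n0 : \n_(repr F) != 0.
  by apply: contra_neq F0 => n0; rewrite [F]frac_numden n0 tofrac0 mul0r.
(* The order at 0 never exceeds the multiplicity of the numerator, so one more than that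
   multiplicity is already impossible. *)
have := small (mup 0 \n_(repr F)).+1; rewrite -uadic_smallP => -[/eqP|].
  by rewrite (negPf F0).
by rewrite /ord_at; move: (mup 0 \n_(repr F)) (mup 0 \d_(repr F)) => k l; lia.
Qed.

Lemma uadic_limit_unique (F : nat -> ratfun) (L L' : ratfun) :
  uadic_limit F L -> uadic_limit F L' -> L = L'.
Proof.
move=> lim lim'; apply/eqP; rewrite -subr_eq0; apply/eqP/uadic_small_all => n.
have [N small] := lim n; have [N' small'] := lim' n.
have -> : L - L' = (L - F (maxn N N')) - (L' - F (maxn N N')) by ring.
by apply: uadic_smallB; apply/uadic_smallP; [apply: small|apply: small']; lia.
Qed.

(** Limits are unique, so the element picked by [xget] is whichever limit can be exhibited. *)
Lemma zetaE (X : digraph) (L : ratfun) :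
  uadic_limit (partial_zeta X) L -> zeta X = L.
Proof.
move=> lim; apply: classical_sets.xget_unique => // L' lim'.
exact: uadic_limit_unique lim' lim.
Qed.

(** * The algebraic rank *)

Lemma clear_denominators (m n : nat) (A : 'M[rat]_(m, n)) :
  exists2 N : int, N != 0 & exists B : 'M[int]_(m, n), map_mx intr B = N%:~R *: A.
Proof.
pose D (P : pred ('I_m * 'I_n)) := \prod_(ij | P ij) denq (A ij.1 ij.2).
exists (D predT); first by apply/prodf_neq0 => ij _; rewrite denq_neq0.
(* Multiplying each numerator by the denominators of all other entries gives an integer entry
   without any division. *)
exists (\matrix_(i, j) (numq (A i j) * D (predC1 (i, j)))).
apply/matrixP => i j; rewrite !mxE {2}/D (bigD1 (i, j)) //= -/(D (predC1 (i, j))).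
rewrite !intrM -{3}(divq_num_den (A i j)).
by field; rewrite intr_eq0 denq_neq0.
Qed.

Local Notation ratmx := (map_mx (intr : int -> rat)).

Lemma ratmx_inj (m n : nat) : injective (ratmx : 'M_(m, n) -> 'M_(m, n)).
Proof.
move=> A B /matrixP AB; apply/matrixP => i j.
by have := AB i j; rewrite !mxE => /intr_inj.
Qed.

(** Linear independence over the integers of the rows of [V] in the quotient by the row lattice of
    [M]. Rows are used because [mxrank] and its subspace calculus are about row spaces; [bf_lattice]
    is a column lattice, whence the transposes below. *)
Definition rows_independent_mod (l n : nat) (V : 'M[int]_(l, n)) (M : 'M[int]_n) : Prop :=
  forall (c : 'rV[int]_l) (w : 'rV[int]_n), c *m V = w *m M -> c = 0.

Lemma rows_independent_modQ (l n : nat) (V : 'M[int]_(l, n)) (M : 'M[int]_n) :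
  rows_independent_mod V M ->
  forall (a : 'rV[rat]_l) (b : 'rV[rat]_n), a *m ratmx V = b *m ratmx M -> a = 0.
Proof.
move=> indep a b eq_ab.
have [N N0 [c cE]] := clear_denominators (row_mx a b).
have N0' : N%:~R != 0 :> rat by rewrite intr_eq0.
have : lsubmx c *m V = rsubmx c *m M.
  apply: ratmx_inj; rewrite !map_mxM map_lsubmx map_rsubmx cE.
  by rewrite scale_row_mx row_mxKl row_mxKr -!scalemxAl eq_ab.
move/indep/(congr1 ratmx); rewrite map_lsubmx cE scale_row_mx row_mxKl map_mx0.
by move/eqP; rewrite scaler_eq0 (negPf N0') => /eqP.
Qed.

(** Over the rationals, [V] is row free and its row space meets that of [M] trivially, so the two
    ranks add up inside dimension [n]. *)
Lemma rows_independent_mod_le (l n : nat) (V : 'M[int]_(l, n)) (M : 'M[int]_n) :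
  rows_independent_mod V M -> (l + \rank (ratmx M) <= n)%N.
Proof.
move=> /rows_independent_modQ indep.
have freeV : row_free (ratmx V).
  apply: inj_row_free => a aV; apply: (indep a 0).
  by rewrite mul0mx.
have capVM : (ratmx V :&: ratmx M)%MS = 0.
  apply/eqP/rowV0P => u; rewrite sub_capmx => /andP[/submxP[a uE] /submxP[b uE']].
  by rewrite uE (indep a b) ?mul0mx // -uE.
have := mxrank_sum_cap (ratmx V) (ratmx M).
rewrite capVM mxrank0 addn0 (eqP freeV) => <-.
exact: rank_leq_col.
Qed.

(** A rational basis of a complement of the row space of [M], scaled to have integer entries,
    attains the bound. *)
Lemma rows_independent_mod_max (n : nat) (M : 'M[int]_n) :
  exists V : 'M[int]_(n - \rank (ratmx M), n), rows_independent_mod V M.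
Proof.
rewrite -(mxrank_compl (ratmx M)); set C := (_^C)%MS.
have [N N0 [V VE]] := clear_denominators (row_base C).
have N0' : N%:~R != 0 :> rat by rewrite intr_eq0.
exists V => c w /(congr1 ratmx); rewrite !map_mxM VE => eq_cw.
have : (ratmx c *m (N%:~R *: row_base C) <= ratmx M :&: C)%MS.
  rewrite sub_capmx {1}eq_cw submxMl -scalemxAr scalemx_sub //.
  by rewrite (submx_trans (submxMl _ _)) // eq_row_base.
rewrite capmx_compl submx0 -scalemxAr scaler_eq0 (negPf N0') /= => /eqP c0.
apply: ratmx_inj; rewrite map_mx0; apply: (row_free_inj (row_base_free C)).
by rewrite c0 mul0mx.
Qed.

Lemma zindependent_bowen_franks (X : digraph) (l : nat) (v : 'I_l -> 'cV[int]_#|vertex X|) :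
  zindependent (fun i => \pi_(bowen_franks X) (v i)) <->
  rows_independent_mod (\matrix_i (v i)^T) (1%:M - adjacency X)^T.
Proof.
have sumE (c : 'I_l -> int) : \sum_i (\pi_(bowen_franks X) (v i)) *~ c i = 0 <->
    exists w, (\row_i c i) *m (\matrix_i (v i)^T) = w *m (1%:M - adjacency X)^T.
  have -> : \sum_i (\pi_(bowen_franks X) (v i)) *~ c i =
            \pi_(bowen_franks X) (\sum_i v i *~ c i).
    rewrite raddf_sum; apply: eq_bigr => i _; exact/esym/raddfMz.
  have -> : (\row_i c i) *m (\matrix_i (v i)^T) = (\sum_i v i *~ c i)^T.
    rewrite mulmx_sum_row raddf_sum; apply: eq_bigr => i _ /=.
    by rewrite rowK mxE -scaler_int linearZ /= intz.
  set s := \sum_i _; rewrite -[X in _ = X](raddf0 (\pi_(bowen_franks X))).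
  split.
    move/eqP; rewrite -Quotient.idealrBE subr0 => /asboolP[w ->].
    by exists w^T; rewrite trmx_mul.
  move=> [w sw]; apply/eqP; rewrite -Quotient.idealrBE subr0.
  by apply/asboolP; exists w^T; apply: trmx_inj; rewrite sw trmx_mul trmxK.
split=> indep.
  move=> c w cw; apply/rowP => i; rewrite mxE; apply: indep.
  apply/sumE; exists w; rewrite -cw; congr (_ *m _).
  by apply/rowP => j; rewrite mxE.
move=> c /sumE[w /indep/rowP c0] i.
by have := c0 i; rewrite !mxE.
Qed.

Lemma algebraic_rankE (X : digraph) :
  algebraic_rank X = (#|vertex X| - \rank (ratmx (1%:M - adjacency X)))%N.
Proof.
set r := \rank _; have rT : \rank (ratmx (1%:M - adjacency X)^T) = r.
  by rewrite -matrix.map_trmx mxrank_tr.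
have ub l (y : 'I_l -> bowen_franks X) : zindependent y -> (l <= #|vertex X| - r)%N.
  move=> indep; rewrite leq_subRL ?rank_leq_col // addnC -rT.
  apply: (rows_independent_mod_le (V := \matrix_i (repr (y i))^T)).
  apply/zindependent_bowen_franks => c.
  under eq_bigr => i _ do rewrite reprK.
  exact: indep.
have [x indx] : exists x : 'I_(#|vertex X| - r) -> bowen_franks X, zindependent x.
  have := rows_independent_mod_max (1%:M - adjacency X)^T; rewrite rT => -[V indep].
  exists (fun i => \pi_(bowen_franks X) (row i V)^T); apply/zindependent_bowen_franks.
  suff -> : \matrix_i ((row i V)^T)^T = V by [].
  by apply/row_matrixP => i; rewrite rowK trmxK.
apply: classical_sets.xget_unique; first by split; [exists x|exact: ub].
move=> k [[y indy] max]; apply/anti_leq.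
by rewrite (ub _ _ indy) (max _ _ indx).
Qed.

(** * Multiplicities of the eigenvalue 1 *)

(** The reversed characteristic polynomial; over a field its multiplicity at 1 is the algebraic
    multiplicity of the eigenvalue 1 of [A]. *)
Definition det1subX (R : comNzRingType) (n : nat) (A : 'M[R]_n) : {poly R} :=
  \det (1%:M - 'X *: map_mx polyC A).

Lemma det1subX_map (R S : comNzRingType) (f : {rmorphism R -> S}) (n : nat) (A : 'M[R]_n) :
  map_poly f (det1subX A) = det1subX (map_mx f A).
Proof.
rewrite /det1subX -det_map_mx map_mxB map_mx1 map_mxZ /= map_polyX -!map_mx_comp.
by congr (\det (_ - _ *: _)); apply/matrixP => i j; rewrite !mxE /= map_polyC.
Qed.

Lemma horner_det1subX (R : comNzRingType) (n : nat) (A : 'M[R]_n) (x : R) :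
  (det1subX A).[x] = \det (1%:M - x *: A).
Proof.
rewrite -horner_evalE /det1subX -det_map_mx; congr (\det _).
by apply/matrixP => i j; rewrite !mxE /= /horner_eval !hornerE hornerMn hornerC.
Qed.

Lemma det1subX_neq0 (R : comNzRingType) (n : nat) (A : 'M[R]_n) : det1subX A != 0.
Proof.
apply: contra_eq_neq (horner_det1subX A 0) => ->.
by rewrite horner0 scale0r subr0 det1 eq_sym oner_neq0.
Qed.

Lemma det1subX_conj (R : idomainType) (n : nat) (P A B : 'M[R]_n) :
  P \in unitmx -> P *m A = B *m P -> det1subX A = det1subX B.
Proof.
move=> Pu eqPA; rewrite /det1subX.
have PuX : map_mx polyC P \in unitmx.
  by rewrite unitmxE det_map_mx rmorph_unit // -unitmxE.
apply: (mulrI (x := \det (map_mx polyC P))); first by rewrite -unitmxE.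
rewrite -det_mulmx [RHS]mulrC -det_mulmx; congr (\det _).
by rewrite mulmxBr mulmxBl mulmx1 mul1mx -scalemxAr -scalemxAl -!map_mxM eqPA.
Qed.

Lemma det1subX_lblock (R : comNzRingType) (m n : nat) (A : 'M[R]_m) C (D : 'M[R]_n) :
  det1subX (block_mx A 0 C D) = det1subX A * det1subX D.
Proof.
rewrite /det1subX map_block_mx map_mx0 scale_block_mx scaler0 scalar_mx_block.
by rewrite opp_block_mx add_block_mx oppr0 addr0 det_lblock.
Qed.

Section Multiplicity.
Variable F : fieldType.

(** Compressing [A] and [D] on both sides to identity matrices of their ranks turns the block matrix
    into a unitriangular one, and compression cannot raise the rank. *)
Lemma mxrank_lblock (m n : nat) (A : 'M[F]_m) C (D : 'M[F]_n) :
  (\rank A + \rank D <= \rank (block_mx A 0 C D))%N.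
Proof.
have compress k (M : 'M[F]_k) : exists R S, R *m M *m S = 1%:M :> 'M_(\rank M).
  exists (pid_mx (\rank M) *m invmx (col_ebase M)), (invmx (row_ebase M) *m pid_mx (\rank M)).
  rewrite -[X in _ *m X *m _](mulmx_ebase M) !mulmxA mulmxKV ?col_ebase_unit //.
  rewrite mulmxK ?row_ebase_unit //.
  by rewrite !pid_mx_id ?rank_leq_row // pid_mx_1.
have [R [S RS]] := compress _ A; have [R' [S' RS']] := compress _ D.
have E : block_mx R 0 0 R' *m block_mx A 0 C D *m block_mx S 0 0 S' =
    block_mx 1%:M 0 (R' *m C *m S) 1%:M.
  by rewrite !mulmx_block !(mulmx0, mul0mx, addr0, add0r) RS RS'.
have : block_mx (1%:M : 'M[F]_(\rank A)) 0 (R' *m C *m S) (1%:M : 'M_(\rank D)) \in unitmx.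
  by rewrite unitmxE det_lblock !det1 mulr1 unitr1.
rewrite -row_free_unit -E -row_leq_rank => /leq_trans; apply.
by rewrite (leq_trans (mxrankM_maxl _ _)) // mxrankM_maxr.
Qed.

(* With [1 - A = L D U], [D] the partial identity of rank [r], the factorisation
   [1 - X A = (1 - A) + (1 - X) A = L (D + (1 - X) B) U] shows [n - r] rows
   divisible by [1 - X]. *)
Lemma geometric_le_algebraic (n : nat) (A : 'M[F]_n) :
  (n - \rank (1%:M - A)%R <= mup 1 (det1subX A))%N.
Proof.
rewrite mup_geq ?det1subX_neq0 // /det1subX.
set M := 1%:M - A; set r := \rank M.
set L := map_mx polyC (col_ebase M); set U := map_mx polyC (row_ebase M).
have Lu : L \in unitmx by rewrite unitmxE det_map_mx rmorph_unit // -unitmxE col_ebase_unit.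
have Uu : U \in unitmx by rewrite unitmxE det_map_mx rmorph_unit // -unitmxE row_ebase_unit.
pose d := diag_mx (\row_(i < n) if (i < r)%N then 1 else 1 - 'X : {poly F}).
pose B := invmx L *m map_mx polyC A *m invmx U.
have -> : 1%:M - 'X *: map_mx polyC A =
    L *m d *m (pid_mx r +
      \matrix_(i, j) (if (i < r)%N then (1 - 'X) * B i j else B i j)) *m U.
  have -> : 1%:M - 'X *: map_mx polyC A = map_mx polyC M + (1 - 'X) *: map_mx polyC A.
    rewrite map_mxB map_mx1 scalerBl scale1r.
    by rewrite addrA subrK.
  rewrite -{1}(mulmx_ebase M) !map_mxM map_pid_mx -/L -/U -/r.
  have -> : map_mx polyC A = L *m B *m U.
    by rewrite /B !mulmxA mulmxKV // mulmxV // mul1mx.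
  rewrite scalemxAl scalemxAr -mulmxDl -mulmxDr -[L *m d *m _]mulmxA; congr (_ *m _ *m _).
  apply/matrixP => i j; rewrite mul_diag_mx !mxE.
  case: ltnP => _; rewrite ?andbT ?andbF /= ?mul1r ?add0r //.
rewrite !det_mulmx det_diag mulrAC -mulrA dvdp_mulr // dvdp_mull //.
rewrite (bigID (fun i : 'I_n => (i < r)%N)) /= dvdp_mull //.
rewrite (eq_bigr (fun=> 1 - 'X)) => [|i /negPf ir]; last by rewrite mxE ir.
rewrite prodr_const -[1 - 'X]opprB exprNn dvdp_mull //.
suff -> : #|[pred i : 'I_n | ~~ (i < r)%N]| = (n - r)%N by [].
rewrite -sum1_card -(big_mkord (fun i => ~~ (i < r)%N) (fun=> 1%N)).
rewrite -[RHS]muln1 -sum_nat_const_nat (big_nat_widenl r 0) //.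
by apply: eq_bigl => i; rewrite -leqNgt.
Qed.

(** The inequality of defects for [A] and [B], with the kernel dimensions moved across so that no
    difference of natural numbers is truncated. *)
Lemma invariant_subspace_defect (m n : nat) (A : 'M[F]_m) (B : 'M[F]_n) (P : 'M[F]_(m, n)) :
  row_free P -> P *m B = A *m P ->
  (mup 1 (det1subX A) + (n - \rank (1%:M - B)%R) <=
   mup 1 (det1subX B) + (m - \rank (1%:M - A)%R))%N.
Proof.
move=> Pfree PB.
have [q nE] : exists q, n = (m + q)%N.
  by exists (n - m)%N; rewrite subnKC // -(eqP Pfree) rank_leq_col.
subst n.
(* The rows of [P] span the first [m] rows of [U], so the last [q] rows complete them to a basis. *)
pose U := row_ebase P; pose G : 'M[F]_(q, m + q) := row_mx 0 1%:M *m U.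
have PE : P = row_mx (col_ebase P) 0 *m U.
  rewrite -{1}(mulmx_ebase P) (eqP Pfree) -/U; congr (_ *m U).
  by rewrite pid_mx_row mul_mx_row mulmx1 mulmx0.
have Qu : col_mx P G \in unitmx.
  have -> : col_mx P G = block_mx (col_ebase P) 0 0 1%:M *m U.
    by rewrite {1}PE -mul_col_mx.
  rewrite unitmx_mul row_ebase_unit andbT unitmxE det_lblock det1 mulr1 -unitmxE.
  exact: col_ebase_unit.
(* [W] holds the coordinates of the rows of [G *m B] in the new basis; the upper blocks [A] and 0
   come from the intertwining relation. *)
pose W := G *m B *m invmx (col_mx P G).
have conj : col_mx P G *m B = block_mx A 0 (lsubmx W) (rsubmx W) *m col_mx P G.
  rewrite mul_col_mx PB mul_block_col mul0mx addr0 -mul_row_col hsubmxK.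
  by rewrite mulmxKV.
rewrite (det1subX_conj Qu conj) det1subX_lblock mupM ?det1subX_neq0 // -addnA leq_add2l.
have -> : \rank (1%:M - B) = \rank (1%:M - block_mx A 0 (lsubmx W) (rsubmx W)).
  have /(congr1 (@mxrank F _ _)) : col_mx P G *m (1%:M - B) =
      (1%:M - block_mx A 0 (lsubmx W) (rsubmx W)) *m col_mx P G.
    by rewrite mulmxBr mulmxBl mulmx1 mul1mx conj.
  rewrite [in RHS]mxrankMfree ?row_free_unit // => <-.
  by rewrite eqmxMfull // row_full_unit.
have := mxrank_lblock (1%:M - A) (- lsubmx W) (1%:M - rsubmx W).
have := geometric_le_algebraic (rsubmx W).
rewrite scalar_mx_block opp_block_mx add_block_mx oppr0 !add0r.
have := rank_leq_row (1%:M - A); have := rank_leq_row (1%:M - rsubmx W).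
move: (\rank (1%:M - A)%R) (\rank (1%:M - rsubmx W)%R) (\rank (block_mx _ _ _ _)).
by move: (mup _ _) => t a b c; lia.
Qed.

End Multiplicity.

(** * Power sums of a polynomial *)

Section PowerSums.
Variable F : fieldType.
Implicit Types (P Q : {poly F}) (s t : nat -> F).

Lemma dvdXnP (n : nat) P : reflect (forall i, (i < n)%N -> P`_i = 0) ('X^n %| P).
Proof.
apply: (iffP idP) => [/dvdpP[Q ->] i ltin|P0]; first by rewrite coefMXn ltin.
rewrite -[P](poly_take_drop n); suff -> : take_poly n P = 0 by rewrite add0r dvdp_mull.
by apply/polyP => i; rewrite coef_take_poly coef0; case: ltnP => // /P0.
Qed.

(** The generating series of [s k] over positive [k], truncated so that identities of power series
    become divisibility by ['X^n]. *)
Definition power_sum_poly (n : nat) s : {poly F} :=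
  \poly_(k < n) (if k == 0%N then 0 else s k).

(* [P = \prod_i (1 - a_i X)] has power sums [s k = \sum_i a_i ^+ k]; the value
   [s 0] is ignored. *)
Definition has_power_sums P s : Prop :=
  forall n, 'X^n %| 'X * P^`() + P * power_sum_poly n s.

Lemma has_power_sums_ext P s t : (forall k, (0 < k)%N -> s k = t k) ->
  has_power_sums P s -> has_power_sums P t.
Proof.
move=> st Ps n; rewrite (_ : power_sum_poly n t = power_sum_poly n s) //.
by apply: eq_poly => -[|k] _ //=; rewrite st.
Qed.

Lemma has_power_sums1 : has_power_sums 1 (fun=> 0).
Proof.
move=> n; rewrite derivC mulr0 add0r mul1r (_ : power_sum_poly n _ = 0) ?dvdp0 //.
by apply/polyP => i; rewrite coef_poly coef0 !if_same.
Qed.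

(** The logarithmic derivative of a product is the sum of those of the factors. *)
Lemma has_power_sumsM P Q s t : has_power_sums P s -> has_power_sums Q t ->
  has_power_sums (P * Q) (fun k => s k + t k).
Proof.
move=> Ps Qt n.
have -> : power_sum_poly n (fun k => s k + t k) = power_sum_poly n s + power_sum_poly n t.
  apply/polyP => i; rewrite coefD !coef_poly.
  by case: ltnP => _; rewrite ?addr0 //; case: (i); rewrite ?addr0.
have -> : 'X * (P * Q)^`() + P * Q * (power_sum_poly n s + power_sum_poly n t) =
    ('X * P^`() + P * power_sum_poly n s) * Q + P * ('X * Q^`() + Q * power_sum_poly n t).
  by rewrite derivM; ring.
by rewrite dvdp_add ?(dvdp_mulr _ (Ps n)) ?(dvdp_mull _ (Qt n)).
Qed.

Lemma has_power_sums_prod (I : Type) (r : seq I) (A : pred I) (P : I -> {poly F})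
    (s : I -> nat -> F) :
  (forall i, A i -> has_power_sums (P i) (s i)) ->
  has_power_sums (\prod_(i <- r | A i) P i) (fun k => \sum_(i <- r | A i) s i k).
Proof.
move=> Ps; elim: r => [|i r IH].
  by rewrite big_nil; apply: has_power_sums_ext has_power_sums1 => k _; rewrite big_nil.
rewrite big_cons; case: ifP => Ai; last first.
  by apply: has_power_sums_ext IH => k _; rewrite big_cons Ai.
apply: has_power_sums_ext (has_power_sumsM (Ps i Ai) IH) => k _.
by rewrite big_cons Ai.
Qed.

(** Here [-X P'/P] is the geometric series [l a X^l / (1 - a X^l)]. In degree below [l] every term
    vanishes, in degree [l] the derivative cancels the first term of the series, and above [l]
    consecutive terms of the series cancel. *)
Lemma has_power_sums_binomial (a : F) (l : nat) : (0 < l)%N ->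
  has_power_sums (1 - a *: 'X^l) (fun k => if (l %| k)%N then l%:R * a ^+ (k %/ l) else 0).
Proof.
move=> l0 n; apply/dvdXnP => j ltjn.
rewrite coefD coefXM coef_deriv mulrBl mul1r -scalerAl !coefB !coefZ coefXnM.
rewrite coefXn coef1 !coef_poly ltjn; case: j ltjn => [|j] ltjn /=.
  by rewrite l0 mulr0 subr0 addr0.
rewrite sub0r mulNrn; have [ltjl|] := ltnP j.+1 l.
  rewrite gtnNdvd //.
  by rewrite (ltn_eqF ltjl) mulr0n !mulr0 mul0rn subr0 oppr0 addr0.
rewrite (leq_ltn_trans (leq_subr _ _) ltjn) subn_eq0 leq_eqVlt.
case/predU1P => [->|ltlj].
  by rewrite eqxx mulr1 leqnn dvdnn divnn /= expr1 mulr0 subr0 mulr_natl addNr.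
rewrite (gtn_eqF ltlj) leqNgt ltlj /= mulr0n mulr0 mul0rn oppr0 add0r.
rewrite dvdn_subl ?dvdnn ?(ltnW ltlj) //.
case: ifP => [/dvdnP[[//|k] ->]|_]; last by rewrite mulr0 subrr.
by rewrite mulSn addKn -mulSn !mulnK // exprS mulrCA subrr.
Qed.

(** The relation is linear in the polynomial, so it holds for [D = P - Q]. In degree [j] it
    expresses [j D_j] through lower coefficients of [D], as in Newton's identities; these vanish by
    induction, and characteristic 0 allows division by [j]. *)
Lemma eq_has_power_sums (n : nat) P Q s t : [pchar F] =i pred0 ->
  P`_0 = Q`_0 -> (forall k, (0 < k < n)%N -> s k = t k) ->
  has_power_sums P s -> has_power_sums Q t -> 'X^n %| P - Q.
Proof.
move=> char0 PQ0 st /(_ n) Ps /(_ n).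
have <- : power_sum_poly n s = power_sum_poly n t.
  by apply: eq_poly => -[//|k] ltkn; apply: st.
move=> Qs; have {Qs Ps} := dvdp_sub Ps Qs.
have -> : 'X * P^`() + P * power_sum_poly n s - ('X * Q^`() + Q * power_sum_poly n s) =
   'X * (P - Q)^`() + (P - Q) * power_sum_poly n s by rewrite derivB; ring.
have : (P - Q)`_0 = 0 by rewrite coefB PQ0 subrr.
move: (P - Q) => D D0 /dvdXnP Ds; apply/dvdXnP; elim/ltn_ind => j IH ltjn.
case: j IH ltjn => [//|j] IH ltjn.
have := Ds _ ltjn; rewrite coefD coefXM /= coef_deriv coefM big_ord_recr /= subnn.
rewrite [(power_sum_poly _ _)`_0]coef_poly if_same mulr0 addr0 big1 ?addr0 => [/eqP|i _].
  rewrite -mulr_natr mulf_eq0 => /orP[/eqP //|].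
  by move/pcharf0P: char0 => ->.
by rewrite IH ?mul0r // (ltn_trans _ ltjn).
Qed.

End PowerSums.

(** Divisibility of polynomials is unchanged by field extension. This brings the determinant formula
    down from [algC], where matrices can be triangularised. *)
Lemma has_power_sums_map (F K : fieldType) (f : {rmorphism F -> K})
    (P : {poly F}) (s : nat -> F) :
  has_power_sums (map_poly f P) (f \o s) -> has_power_sums P s.
Proof.
move=> Ps n; rewrite -(dvdp_map f) map_polyXn rmorphD !rmorphM /= map_polyX -deriv_map.
rewrite (_ : map_poly f (power_sum_poly n s) = power_sum_poly n (f \o s)) //.
apply/polyP => i; rewrite coef_map !coef_poly; case: ltnP => _; last exact: raddf0.
by case: (i) => [|k]; first exact: raddf0.
Qed.

Lemma trig_mx_exp (R : nzRingType) (n : nat) (T : 'M[R]_n) (k : nat) :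
  is_trig_mx T -> is_trig_mx (T ^+ k) /\ forall i, (T ^+ k) i i = T i i ^+ k.
Proof.
move=> /is_trig_mxP trigT; elim: k => [|k [/is_trig_mxP trigTk diag]].
  by split=> [|i]; rewrite expr0 ?scalar_mx_is_trig // mxE eqxx.
rewrite exprS; split=> [|i].
  apply/is_trig_mxP => i j ltij; rewrite mxE big1 // => l _.
  have [ltil|leli] := ltnP i l; first by rewrite trigT ?mul0r.
  by rewrite (trigTk l j) ?mulr0 // (leq_ltn_trans leli).
rewrite exprS mxE (bigD1 i) //= diag big1 ?addr0 // => l li.
have [ltil|leli] := ltnP i l; first by rewrite trigT ?mul0r.
by rewrite (trigTk l i) ?mulr0 // ltn_neqAle leli andbT.
Qed.

(** Determinant and traces are invariant under conjugation, so by Schur [A] may be taken triangular.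
    Then the determinant is the product of the [1 - T i i X] and the traces are the power sums of
    the diagonal. *)
Lemma has_power_sums_det (n : nat) (A : 'M[algC]_n) :
  has_power_sums (det1subX A) (fun k => \tr (A ^+ k)).
Proof.
case: n A => [|n] A.
  rewrite /det1subX det_mx00; apply: has_power_sums_ext (has_power_sums1 _) => k _.
  by rewrite /mxtrace big_ord0.
have [P /unitarymx_unit Pu] := Schur A (ltn0Sn n); rewrite /similar_to conjumx //.
have : P *m A = (P *m A *m invmx P) *m P by rewrite mulmxKV.
move: (P *m A *m invmx P) => T PA /= trigT.
have PAk k : P *m (A ^+ k) = (T ^+ k) *m P.
  elim: k => [|k IH]; first by rewrite !expr0 mulmx1 mul1mx.
  by rewrite [A ^+ _]exprS [T ^+ _]exprS -mulmxE mulmxA PA -mulmxA IH mulmxA.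
rewrite (det1subX_conj Pu PA).
have trE k : \tr (A ^+ k) = \sum_i T i i ^+ k.
  rewrite -(mulKmx Pu (A ^+ k)) PAk mxtrace_mulC mulmxK //.
  by apply: eq_bigr => i _; rewrite (trig_mx_exp k trigT).2.
have -> : det1subX T = \prod_(i < n.+1) (1 - T i i *: 'X^1).
  rewrite /det1subX det_trig.
    by apply: eq_bigr => i _; rewrite !mxE eqxx -mul_polyC mulrC expr1.
  apply/is_trig_mxP => i j ltij; rewrite !mxE (is_trig_mxP trigT) // polyC0 mulr0.
  by rewrite subr0 -val_eqE /= (ltn_eqF ltij).
apply: has_power_sums_ext (has_power_sums_prod _ (fun i _ =>
  has_power_sums_binomial (T i i) (ltn0Sn 0))) => k _.
by rewrite trE; apply: eq_bigr => i _; rewrite dvd1n divn1 mul1r.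
Qed.

(** * Primitive words *)

Lemma dvdn_order (T : finType) (f : T -> T) (x : T) (i : nat) : injective f ->
  (order f x %| i)%N = (iter i f x == x).
Proof.
move=> finj; have iter_mul q : iter (q * order f x) f x = x.
  by elim: q => // q IH; rewrite mulSn iterD IH iter_order.
apply/idP/eqP => [/dvdnP[q ->] //|].
rewrite {1}(divn_eq i (order f x)) addnC iterD iter_mul => fix_r.
have ltr : (i %% order f x < order f x)%N by rewrite ltn_mod order_gt0.
have := findex_iter ltr; rewrite fix_r /dvdn => <-.
by apply/eqP; apply: (findex_iter (order_gt0 f x)).
Qed.

Lemma order_conj (T U : finType) (f : T -> T) (g : U -> U) (h : T -> U) (x : T) :
  injective f -> injective g -> injective h -> (forall y, h (f y) = g (h y)) ->
  order g (h x) = order f x.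
Proof.
move=> finj ginj hinj hfg.
have hiter i : h (iter i f x) = iter i g (h x) by elim: i => //= i <-.
apply/eqP; rewrite eqn_dvd !dvdn_order // -hiter iter_order // eqxx.
by rewrite -(inj_eq hinj) hiter iter_order ?eqxx.
Qed.

Section Words.
Variable T : eqType.
Implicit Types (s c : seq T) (m : nat).

Definition word_exp m c := flatten (nseq m c).

Lemma size_word_exp m c : size (word_exp m c) = (m * size c)%N.
Proof. by rewrite size_flatten /shape map_nseq sumn_nseq mulnC. Qed.

Lemma word_expS m c : word_exp m.+1 c = c ++ word_exp m c.
Proof. by []. Qed.

Lemma word_expSr m c : word_exp m.+1 c = word_exp m c ++ c.
Proof. by elim: m => [|m IH]; rewrite /word_exp /= ?cats0 // -catA -IH. Qed.

Lemma word_exp_cons m x s : rcons (word_exp m (x :: s)) x = x :: word_exp m (rcons s x).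
Proof.
by elim: m => // m IH; rewrite !word_expS rcons_cat IH /= cat_rcons.
Qed.

Lemma word_exp_rot m c : word_exp m (rot 1 c) = rot 1 (word_exp m c).
Proof.
case: c => [|x s]; first by rewrite /word_exp; elim: m.
case: m => // m; rewrite rot1_cons !word_expS cat_cons rot1_cons cat_rcons.
by rewrite rcons_cat word_exp_cons.
Qed.

Lemma rot_word_exp m c : rot (size c) (word_exp m c) = word_exp m c.
Proof.
case: m => [|m]; first by rewrite /word_exp /= /rot; case: (size c).
by rewrite {1}word_expS rot_size_cat -word_expSr.
Qed.

(** Commutation forces [s] to begin with [c], and after cancelling this prefix the remainder still
    commutes with [c]. *)
Lemma commuting_word_exp m s c :
  c ++ s = s ++ c -> size s = (m * size c)%N -> s = word_exp m c.
Proof.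
elim: m s => [|m IH] s comm size_s; first by apply: size0nil; rewrite size_s.
have le_cs : (size c <= size s)%N by rewrite size_s leq_pmull.
have sE : s = c ++ drop (size c) s.
  rewrite -{1}(cat_take_drop (size c) s); congr (_ ++ _).
  have := congr1 (take (size c)) comm.
  by rewrite take_size_cat // takel_cat.
rewrite sE; congr (_ ++ _); apply: IH; last by rewrite size_drop size_s mulSn addKn.
by move: comm; rewrite {1 2}sE -catA => /eqP; rewrite eqseq_cat // => /andP[_ /eqP].
Qed.

Lemma rot_fixed_word_exp m l s :
  size s = (m.+1 * l)%N -> rot l s = s -> s = word_exp m.+1 (take l s).
Proof.
move=> size_s fix_s; have size_l : size (take l s) = l.
  by rewrite size_takel // size_s leq_pmull.
rewrite -{1}(cat_take_drop l s); congr (_ ++ _); apply: commuting_word_exp.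
  by rewrite cat_take_drop.
by rewrite size_l size_drop size_s mulSn addKn.
Qed.

Lemma cycle_word_exp (e : rel T) m c : (0 < m)%N ->
  path.cycle e (word_exp m c) = path.cycle e c.
Proof.
case: c => [|x s]; first by move=> _; rewrite /word_exp; elim: m.
case: m => // m _; rewrite word_expS /= rcons_cat word_exp_cons -cat_rcons cat_path last_rcons.
apply/andb_idr => cyc; elim: m => // m IH.
by rewrite word_expS cat_path last_rcons cyc.
Qed.

End Words.

Section RotTuple.
Variable T : finType.

Definition rot1_tuple k (t : k.-tuple T) : k.-tuple T := [tuple of rot 1 t].

Lemma rot1_tuple_inj k : injective (@rot1_tuple k).
Proof. by move=> s t /(congr1 val) /= /rot_inj /val_inj. Qed.

Lemma iter_rot1_tuple k (t : k.-tuple T) i : (i <= k)%N ->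
  iter i (@rot1_tuple k) t = [tuple of rot i t].
Proof.
elim: i => [|i IH] ltik; apply/val_inj; rewrite /= ?rot0 // IH ?(ltnW ltik) //=.
by rewrite -rotS // size_tuple.
Qed.

(** For positive [k]: the [k] rotations of [t] are pairwise distinct. *)
Definition primitive k (t : k.-tuple T) := order (@rot1_tuple k) t == k.

Lemma order_rot1_dvd k (t : k.-tuple T) i : (i <= k)%N ->
  (order (@rot1_tuple k) t %| i)%N = (rot i t == t).
Proof.
by move=> leik; rewrite dvdn_order ?iter_rot1_tuple //; apply: rot1_tuple_inj.
Qed.

Lemma order_rot1_dvd_size k (t : k.-tuple T) : (order (@rot1_tuple k) t %| k)%N.
Proof. by rewrite order_rot1_dvd // -{1}(size_tuple t) rot_size. Qed.

Lemma word_exp_tupleP m l (c : l.-tuple T) : size (word_exp m c) == (m * l)%N.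
Proof. by rewrite size_word_exp size_tuple. Qed.
Canonical word_exp_tuple m l c := Tuple (@word_exp_tupleP m l c).

Lemma word_exp_tuple_inj m l : (0 < m)%N -> injective (@word_exp_tuple m l).
Proof.
case: m => // m _ c c' /(congr1 val) /= /(congr1 (take l)).
by rewrite /word_exp /= !take_size_cat ?size_tuple // => /val_inj.
Qed.

(** The [m]-th power is the bijection: it commutes with rotation and is injective, hence preserves
    rotation orders, and a word fixed by rotation through [l] is the power of its prefix of length
    [l]. *)
Lemma card_order_rot1 (P : pred (seq T)) m l : (0 < m)%N -> (0 < l)%N ->
  (forall c, P (word_exp m c) = P c) ->
  #|[set t : (m * l).-tuple T | P t && (order (@rot1_tuple _) t == l)]| =
  #|[set c : l.-tuple T | P c && primitive c]|.
Proof.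
move=> m0 l0 Pexp; rewrite -(card_imset _ (@word_exp_tuple_inj m l m0)).
have orderE (c : l.-tuple T) :
    order (@rot1_tuple _) (word_exp_tuple m c) = order (@rot1_tuple l) c.
  apply: order_conj; [exact: rot1_tuple_inj|exact: rot1_tuple_inj| |].
    exact: word_exp_tuple_inj.
  by move=> c'; apply/val_inj; rewrite /= word_exp_rot.
apply: eq_card => t; rewrite inE; apply/andP/imsetP => [[Pt ordt]|[c]]; last first.
  by rewrite inE => /andP[Pc primc] ->; rewrite orderE Pexp.
have rot_t : rot l t = t.
  by apply/eqP; rewrite -order_rot1_dvd ?leq_pmull // (eqP ordt).
have tE : val t = word_exp m (take l t).
  case: m m0 t {Pexp orderE Pt ordt} rot_t => // m _ t.
  by apply: rot_fixed_word_exp; rewrite size_tuple.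
have sz : size (take l t) == l by rewrite size_takel // size_tuple leq_pmull.
have tE' : t = word_exp_tuple m (Tuple sz) by apply/val_inj.
by exists (Tuple sz) => //; rewrite inE /primitive -orderE -tE' ordt -Pexp -tE Pt.
Qed.

Lemma card_sum_primitive (P : pred (seq T)) k : (0 < k)%N ->
  (forall m c, (0 < m)%N -> P (word_exp m c) = P c) ->
  #|[set t : k.-tuple T | P t]| =
  (\sum_(1 <= l < k.+1 | (l %| k)%N) #|[set c : l.-tuple T | P c && primitive c]|)%N.
Proof.
move=> k0 Pexp.
pose F l := #|[set t : k.-tuple T | P t && (order (@rot1_tuple k) t == l)]|.
have le_order t : (order (@rot1_tuple k) t <= k)%N.
  exact: dvdn_leq (order_rot1_dvd_size t).
transitivity (\sum_(l < k.+1) F l)%N.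
  rewrite -sum1dep_card.
  rewrite (partition_big (fun t => inord (order (@rot1_tuple k) t) : 'I_k.+1) predT) //=.
  apply: eq_bigr => l _; rewrite /F -sum1dep_card; apply: eq_bigl => t.
  by rewrite -val_eqE /= inordK // ltnS.
(* Orders are positive, so the term at 0 is empty; terms at non-divisors of [k] vanish below. *)
rewrite -(big_mkord xpredT F) big_ltn // [F 0%N]eq_card0 => [|t]; last first.
  by rewrite inE eqn0Ngt order_gt0 andbF.
rewrite add0n [RHS]big_mkcond; apply: eq_big_nat => l /andP[l0 _].
case: ifP => [/dvdnP[m km]|ndvd]; last first.
  apply: eq_card0 => t; rewrite inE; apply/negP => /andP[_ /eqP lE].
  by rewrite -lE order_rot1_dvd_size in ndvd.
have m0 : (0 < m)%N by move: k0; rewrite km muln_gt0 => /andP[].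
by rewrite /F {F le_order k0}; subst k; apply: card_order_rot1 => // c; apply: Pexp.
Qed.

(** Each rotation orbit of a primitive word has exactly [l] elements, all primitive and all
    satisfying [P]. The orbits are written as in [rot_class]. *)
Lemma card_primitive (P : pred (seq T)) l : (0 < l)%N ->
  (forall i c, P (rot i c) = P c) ->
  #|[set c : l.-tuple T | P c && primitive c]| =
  (l * #|[set [set [tuple of rot i c] | i : 'I_l] |
           c : l.-tuple T & P c && primitive c]|)%N.
Proof.
move=> l0 Prot; set S := [set c | _].
pose orb (c : l.-tuple T) := [set [tuple of rot i c] | i : 'I_l].
have orbE c : orb c = [set c' | fconnect (@rot1_tuple l) c c'].
  apply/setP => c'; rewrite inE; apply/imsetP/idP => [[i _ ->]|conn].
    by rewrite -iter_rot1_tuple ?fconnect_iter // ltnW.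
  have lti := leq_trans (findex_max conn) (dvdn_leq l0 (order_rot1_dvd_size c)).
  exists (Ordinal lti) => //; rewrite -iter_rot1_tuple ?iter_findex //.
  exact: ltnW.
have -> : [set orb c | c : l.-tuple T & P c && primitive c] = orb @: S.
  by apply/setP => C; apply/imsetP/imsetP => -[c cP ->]; exists c; rewrite // !inE in cP *.
rewrite -sum1_card (partition_big_imset orb) /= mulnC -sum_nat_const.
apply: eq_bigr => _ /imsetP[c cS ->].
have primc : primitive c by move: cS; rewrite inE => /andP[].
rewrite sum1dep_card -[RHS](eqP primc).
apply: eq_card => c'; rewrite !inE.
have sym := fconnect_sym (@rot1_tuple_inj l).
apply/andP/idP => [[_ /eqP orbE'] | conn].
  by have : c' \in orb c' by [rewrite orbE inE connect0]; rewrite orbE' orbE inE.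
have same := same_connect sym conn; split; last first.
  by apply/eqP/setP => x; rewrite !orbE !inE same.
have : c' \in orb c by rewrite orbE inE.
case/imsetP => i _ c'E; apply/andP; split.
  by rewrite c'E Prot; move: cS; rewrite inE => /andP[].
by rewrite /primitive /order -(eq_card same).
Qed.

End RotTuple.

(** * The zeta function *)

Section ClosedPaths.
Variable X : digraph.

(** Explicit endpoints let the empty path be counted at each vertex, in accordance with the identity
    matrix as zeroth power. *)
Fixpoint walk (v w : vertex X) (s : seq (edge X)) : bool :=
  if s is e :: s' then (org e == v) && walk (tgt e) w s' else v == w.

Lemma closed_path_cons (e : edge X) (s : seq (edge X)) :
  closed_path (e :: s) = walk (tgt e) (org e) s.
Proof.
rewrite /closed_path /=; elim: s {1 3}e => [|a s IH] b; rewrite /= ?andbT //.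
by rewrite IH eq_sym.
Qed.

Lemma adjacency_exp (k : nat) (i j : 'I_#|vertex X|) :
  (adjacency X ^+ k) i j =
  #|[set t : k.-tuple (edge X) | walk (enum_val j) (enum_val i) t]|%:Z.
Proof.
elim: k i j => [|k IH] i j.
  have walk0 (t : 0.-tuple (edge X)) : walk (enum_val j) (enum_val i) t = (i == j).
    by rewrite tuple0 /= (inj_eq enum_val_inj) eq_sym.
  rewrite expr0 mxE -sum1dep_card (eq_bigl _ _ walk0).
  by case: eqP => _; rewrite ?big_pred0_eq // sum1_card card_tuple.
(* The column index of [adjacency] is the origin, so the rightmost factor corresponds to the first
   edge. *)
rewrite exprSr mxE -sum1dep_card.
rewrite (reindex (fun et : edge X * k.-tuple (edge X) => cons_tuple et.1 et.2)) /=; last first.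
  exists (fun t => (thead t, behead_tuple t)) => [[e t] _|t _] /=.
    by rewrite theadE; congr pair; apply/val_inj.
  by rewrite [RHS]tuple_eta; apply/val_inj.
rewrite -(pair_big_dep (fun e => org e == enum_val j)
  (fun e (t : k.-tuple _) => walk (tgt e) (enum_val i) t) (fun _ _ => 1%N)) /=.
rewrite (partition_big (fun e => enum_rank (tgt e)) predT) //=.
rewrite (big_morph Posz PoszD (erefl _)); apply: eq_bigr => l _.
rewrite IH mxE -PoszM mulnC -sum_nat_const; congr (Posz _).
apply: eq_big => [e|e]; rewrite !inE.
  by rewrite -(inj_eq enum_val_inj) enum_rankK.
by case/andP=> _ /eqP <-; rewrite sum1dep_card.
Qed.

(** A nonempty closed path is counted by one diagonal entry only, that of the origin of its first
    edge. *)
Lemma mxtrace_adjacency_exp (k : nat) : (0 < k)%N ->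
  \tr (adjacency X ^+ k) = #|[set t : k.-tuple (edge X) | closed_path t]|%:Z.
Proof.
case: k => // k _; rewrite /mxtrace (eq_bigr _ (fun i _ => adjacency_exp k.+1 i i)).
rewrite -(big_morph Posz PoszD (erefl _)); congr (Posz _).
rewrite (reindex enum_rank) /=; last exact/onW_bij/enum_rank_bij.
under eq_bigr do rewrite -sum1dep_card big_mkcond.
rewrite exchange_big -sum1dep_card [RHS]big_mkcond; apply: eq_bigr => t _.
case/tupleP: t => e t; rewrite closed_path_cons (bigD1 (org e)) //= enum_rankK eqxx /=.
rewrite big1 ?addn0 // => v ve.
by rewrite enum_rankK eq_sym (negPf ve).
Qed.

Lemma closed_path_rot (i : nat) (c : seq (edge X)) : closed_path (rot i c) = closed_path c.
Proof. by rewrite /closed_path size_rot rot_cycle. Qed.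

Lemma closed_path_exp (m : nat) (c : seq (edge X)) : (0 < m)%N ->
  closed_path (word_exp m c) = closed_path c.
Proof.
by move=> m0; rewrite /closed_path cycle_word_exp // size_word_exp muln_gt0 m0.
Qed.

Lemma prime_cycleP (l : nat) (c : l.-tuple (edge X)) : (0 < l)%N ->
  `[< prime_cycle c >] = closed_path c && primitive c.
Proof.
move=> l0; apply/asboolP/andP => -[closed prim]; split=> //; last first.
  move=> m c' m1 closed' cE.
  have size_c : l = (m * size c')%N by rewrite -size_word_exp -(size_tuple c) cE.
  have lt_l : (size c' < l)%N by rewrite size_c ltn_Pmull // (andP closed').1.
  have : (order (@rot1_tuple _ l) c %| size c')%N.
    by rewrite order_rot1_dvd ?(ltnW lt_l) // cE rot_word_exp.
  by rewrite (eqP prim) gtnNdvd // (andP closed').1.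
(* The quotient of [l] by the rotation order is not 0; if it is 1 the word is primitive, and if it
   is at least 2 the path is a proper power, against primality. *)
have /dvdnP[[|[|m]] lE] := order_rot1_dvd_size c; first by rewrite lE in l0.
  by rewrite /primitive [X in _ == X]lE mul1n.
set o := order _ _ in lE.
have leol : (o <= l)%N by rewrite lE leq_pmull.
have cE : val c = word_exp m.+2 (take o c).
  by apply: rot_fixed_word_exp; [rewrite size_tuple|apply/eqP; rewrite -order_rot1_dvd].
case: (prim m.+2 (take o c)) => //.
by rewrite -(@closed_path_exp m.+2) // -cE.
Qed.

Lemma card_closed_paths (k : nat) : (0 < k)%N ->
  #|[set t : k.-tuple (edge X) | closed_path t]| =
  (\sum_(1 <= l < k.+1 | l %| k) l * #|primes_of_length X l|)%N.
Proof.
move=> k0; rewrite (card_sum_primitive k0 closed_path_exp) big_nat_cond [RHS]big_nat_cond.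
apply: eq_bigr => l /andP[/andP[l0 _] _].
rewrite (card_primitive l0 closed_path_rot); congr (_ * _)%N; apply: eq_card => C.
by apply/imsetP/imsetP => -[c cP ->]; exists c; rewrite // !inE prime_cycleP in cP *.
Qed.

Definition euler_poly (N : nat) : {poly rat} :=
  \prod_(1 <= l < N.+1) \prod_(C in primes_of_length X l) (1 - 'X^l).

Lemma horner_euler_poly0 (N : nat) : (euler_poly N).[0] = 1.
Proof.
rewrite horner_prod big_nat_cond big1 // => l /andP[/andP[l0 _] _].
rewrite horner_prod big1 // => C _.
by rewrite hornerD hornerN hornerC hornerXn expr0n gtn_eqF ?subr0.
Qed.

Lemma partial_zetaE (N : nat) : partial_zeta X N = (tofrac (euler_poly N))^-1.
Proof.
rewrite /partial_zeta /euler_poly rmorph_prod -prodfV; apply: eq_bigr => l _.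
by rewrite rmorph_prod -prodfV.
Qed.

Lemma has_power_sums_euler (N : nat) :
  has_power_sums (euler_poly N) (fun k => \sum_(1 <= l < N.+1)
    \sum_(C in primes_of_length X l) if (l %| k)%N then l%:R else 0).
Proof.
rewrite /euler_poly big_nat_cond.
apply: (@has_power_sums_ext _ _ (fun k => \sum_(1 <= l < N.+1 | (1 <= l < N.+1)%N && true)
    \sum_(C in primes_of_length X l) if (l %| k)%N then l%:R else 0)) => [k _|].
  by rewrite [RHS]big_nat_cond.
apply: has_power_sums_prod => l /andP[/andP[l0 _] _].
apply: has_power_sums_prod => C _.
have := has_power_sums_binomial (1 : rat) l0; rewrite scale1r.
by apply: has_power_sums_ext => k _; rewrite expr1n mulr1.
Qed.

Let D := det1subX (ratmx (adjacency X)).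

Lemma has_power_sums_det_adjacency :
  has_power_sums D (fun k => (\tr (adjacency X ^+ k))%:~R).
Proof.
apply: (has_power_sums_map (f := ratr : {rmorphism rat -> algC})).
rewrite /D det1subX_map.
apply: has_power_sums_ext (has_power_sums_det _) => k _ /=.
rewrite (_ : map_mx ratr (ratmx _) = map_mx intr (adjacency X)); last first.
  by apply/matrixP => i j; rewrite !mxE ratr_int.
by rewrite ratr_int -rmorphXn trace_map_mx.
Qed.

Lemma euler_poly_det (n N : nat) : (n <= N)%N -> 'X^n %| euler_poly N - D.
Proof.
move=> lenN; apply: eq_has_power_sums (has_power_sums_euler N) has_power_sums_det_adjacency.
- exact: pchar_num.
- by rewrite -!horner_coef0 horner_euler_poly0 horner_det1subX scale0r subr0 det1.
move=> k /andP[k0 ltkn].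
rewrite mxtrace_adjacency_exp // card_closed_paths // -pmulrn natr_sum.
(* Primes longer than [k] do not affect the [k]-th power sum, so for [k < n <= N] the truncation at
   [N] loses nothing. *)
rewrite (@big_cat_nat _ _ _ k.+1) //=; last by lia.
rewrite [X in _ + X]big_nat_cond [X in _ + X]big1 ?addr0 => [|l]; last first.
  by rewrite andbT => /andP[ltkl _]; rewrite gtnNdvd // big1.
rewrite [RHS]big_mkcond; apply: eq_bigr => l _; rewrite sumr_const.
by case: ifP => _; rewrite ?mul0rn // natrM mulr_natr.
Qed.

Lemma zeta_det : zeta X = (tofrac D)^-1.
Proof.
apply: zetaE => n; exists n => N leN; apply/uadic_smallP.
have /dvdpP[q qE] := euler_poly_det leN.
have D0 : D != 0 by apply: det1subX_neq0.
have EN0 := horner_euler_poly0 N.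
have EN : euler_poly N != 0.
  by apply: contra_eq_neq EN0 => ->; rewrite horner0 eq_sym oner_neq0.
(* With [E] the Euler polynomial, [1/D - 1/E = (E - D)/(D E)]: the numerator is divisible by ['X^n]
   and the denominator has constant term 1. *)
exists q, (D * euler_poly N); split.
  by rewrite hornerM EN0 mulr1 horner_det1subX scale0r subr0 det1 oner_neq0.
rewrite partial_zetaE [_ * q]mulrC -qE -[_ ^-1]mul1r -[X in _ - X]mul1r -mulNr.
by rewrite addf_div ?tofrac_eq0 // !mul1r mulN1r -rmorphB -rmorphM.
Qed.

End ClosedPaths.

Lemma analytic_rankE (X : digraph) :
  analytic_rank X = (mup 1 (det1subX (ratmx (adjacency X))))%:Z.
Proof. by rewrite /analytic_rank zeta_det ord_at_inv ?opprK // det1subX_neq0. Qed.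

(** * Coverings *)

Definition pullback_mx (R : pzRingType) (Y X : digraph) (f : dihom Y X) :
    'M[R]_(#|vertex X|, #|vertex Y|) :=
  \matrix_(i, j) (vmap f (enum_val j) == enum_val i)%:R.

(** At a vertex [v] of [X] and [w] of [Y], the left side counts the edges out of [w] that end over
    [v], and the right side the edges from the image of [w] to [v]; [emap f] matches them
    bijectively. *)
Lemma pullback_adjacency (Y X : digraph) (f : dihom Y X) :
  covering f -> pullback_mx int f *m adjacency Y = adjacency X *m pullback_mx int f.
Proof.
move=> [_ _ cov]; apply/matrixP => i j; rewrite !mxE.
set w := enum_val j; set v := enum_val i.
have [_ _ inj img] := cov w.
transitivity (#|[set e in out_edges w | vmap f (tgt e) == v]|%:Z).
  rewrite -sum1_card (partition_big (fun e => enum_rank (tgt e)) predT) //=.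
  rewrite (big_morph Posz PoszD (erefl _)); apply: eq_bigr => k _.
  rewrite !mxE sum1_card -natz -natrM natz; congr (Posz _).
  have [wk|wk] := eqVneq; [rewrite mul1n|rewrite mul0n]; last first.
    apply/esym/eq_card0 => e; rewrite unfold_in !inE; apply/negP => /andP[/andP[_ te] /eqP ke].
    by rewrite -ke enum_rankK te in wk.
  apply: eq_card => e; rewrite [RHS]unfold_in !inE -(inj_eq enum_val_inj) enum_rankK -/w.
  by case: (tgt e =P _) => [->|_]; rewrite ?andbF // wk eqxx !andbT.
transitivity (#|[set e in out_edges (vmap f w) | tgt e == v]|%:Z); last first.
  rewrite (bigD1 (enum_rank (vmap f w))) //= big1 ?addr0 => [|k kw].
    rewrite !mxE enum_rankK eqxx mulr1; congr (Posz _).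
    by apply: eq_card => e; rewrite !inE.
  rewrite !mxE; case: eqP => [fwk|_]; last by rewrite mulr0.
  by rewrite fwk enum_valK eqxx in kw.
rewrite -img; congr _%:Z; rewrite -(card_in_imset (f := emap f)).
  apply: eq_card => e; rewrite !inE.
  apply/imsetP/andP => [[e']|[/imsetP[e' out ->] te]].
    by rewrite inE => /andP[out te] ->; rewrite imset_f // -vmap_tgt te.
  by exists e'; rewrite // inE out vmap_tgt te.
by move=> e e' /setIdP[out _] /setIdP[out' _]; apply: inj.
Qed.

Lemma row_free_pullback (Y X : digraph) (f : dihom Y X) :
  covering f ->
  row_free (pullback_mx rat f).
Proof.
move=> [/choice[s sE] _ _]; apply/row_freeP.
(* Restriction of functions along the section [s] of the vertex map is a right inverse of the
   pullback. *)
exists (\matrix_(j, i) (enum_val j == s (enum_val i))%:R).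
apply/matrixP => i i'; rewrite !mxE (bigD1 (enum_rank (s (enum_val i')))) //=.
rewrite big1 ?addr0 => [|j ji]; last first.
  rewrite !mxE; case: (enum_val j =P _) => [js|_]; last by rewrite mulr0.
  by rewrite -js enum_valK eqxx in ji.
by rewrite !mxE enum_rankK eqxx mulr1 sE (inj_eq enum_val_inj) eq_sym.
Qed.

Lemma defect_covering (Y X : digraph) (f : dihom Y X) :
  covering f -> defect X <= defect Y.
Proof.
move=> cov; have := invariant_subspace_defect (row_free_pullback cov).
move=> /(_ (ratmx (adjacency X)) (ratmx (adjacency Y))).
have PQ : ratmx (pullback_mx int f) = pullback_mx rat f.
  by apply/matrixP => i j; rewrite !mxE; case: eqP.
rewrite -PQ -!map_mxM pullback_adjacency // => /(_ erefl).
rewrite /defect !analytic_rankE !algebraic_rankE !map_mxB !map_mx1.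
by rewrite lerBlDr addrAC lerBrDr -!PoszD lez_nat.
Qed.

Theorem theoremC (p d : nat) (X : tower) :
  prime p -> (1 <= d)%N -> Zpd_tower p d X ->
  (forall n : nat, strongly_connected (X n)) ->
  forall n : nat, (1 <= n)%N -> (defect (X n.-1) <= defect (X n))%R.
Proof.
move=> _ _ [cov _] _ [//|n] _.
exact: defect_covering (cov n).
Qed.
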